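(* Let $p=\bigoplus_{i=1}^{m}n_i\delta^{t_i}$ and $p'=\bigoplus_{j=1}^{m'}n'_j\delta^{t'_j}$ be polynomials. Then $$p\odot^\sharp p'=\bigwedge_{j=1}^{m'}\bigoplus_{i=1}^{m}\left(n_i\delta^{t_i}\odot^\sharp n'_j\delta^{t'_j}\right).$$
   Context: Let $\overline{\mathbb Z}=\mathbb Z\cup\{-\infty,+\infty\}$ with its standard order. A counter is a map $s:\overline{\mathbb Z}\to\overline{\mathbb Z}$ that is non-decreasing for the standard order and satisfies $s(-\infty)=-\infty$, $s(+\infty)=+\infty$; $\Sigma$ is the set of counters. Thus a counter is determined by its values on $\mathbb Z$. The order on $\Sigma$ is $s\preceq s'$ iff $s(t)\ge s'(t)$ (standard order, reversed) for all $t\in\mathbb Z$; on $\mathbb Z$, $s\oplus s'$ is the pointwise standard minimum (join for $\preceq$) and $s\wedge s'$ the pointwise standard maximum (meet for $\preceq$). The Hadamard product of $s_1,s_2\in\Sigma$ is the counter $s_1\odot s_2$ with $(s_1\odot s_2)(t)=s_1(t)+s_2(t)$ for all $t\in\mathbb Z$, where $(+\infty)+(-\infty)=+\infty$. For $y,a\in\Sigma$, $y\odot^\sharp a$ denotes the greatest (for $\preceq$) counter $x\in\Sigma$ such that $a\odot x\preceq y$; it always exists. A monomial $n\delta^{t_0}$ ($n,t_0\in\overline{\mathbb Z}$) denotes the counter with value $n$ at every $t\in\mathbb Z$ with $t\le t_0$ and $+\infty$ at every $t\in\mathbb Z$ with $t>t_0$. A polynomial is a counter written as a finite sum $\bigoplus_{i=1}^{m}n_i\delta^{t_i}$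 of monomials, $m\ge1$, with $n_i<n_{i+1}$ and $t_i<t_{i+1}$ (standard order). *)

(* Defs.v *)
From HB Require Import structures.
From mathcomp Require Import all_boot all_order all_algebra.
From mathcomp Require Import boolp classical_sets constructive_ereal.
From mathcomp Require Import zify.

Set Implicit Arguments.
Unset Strict Implicit.
Unset Printing Implicit Defensive.

Import Order.TTheory GRing.Theory Num.Theory.
Import DualAddTheoryNumDomain DualAddTheoryRealDomain.
Local Open Scope ring_scope.
Local Open Scope ereal_scope.

Record counter := Counter {
  counter_fun :> \bar int -> \bar int ;
  counter_homo : {homo counter_fun : t u / t <= u} ;
  counterNy : counter_fun -oo = -oo ;
  countery : counter_fun +oo = +oo
}.

Lemma counter_eqP (s s' : counter) :
  (forall t : int, s t%:E = s' t%:E) -> s = s'.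
Proof.
case: s s' => [f fh fN fy] [g gh gN gy] /= fg.
have E : f = g by apply: funext => -[t||]; rewrite ?fN ?gN ?fy ?gy.
by subst g; congr Counter; apply: Prop_irrelevance.
Qed.

HB.instance Definition _ := gen_eqMixin counter.
HB.instance Definition _ := gen_choiceMixin counter.

(* Sigma is ordered by the reverse of the pointwise order, so that the sum
   of counters (pointwise minimum) is the join and pointwise maximum is the
   meet. *)
Definition counter_le (s s' : counter) : bool :=
  `[< forall t : int, s' t%:E <= s t%:E >].

Lemma counter_le_refl : reflexive counter_le.
Proof. by move=> s; apply/asboolP => t. Qed.

Lemma counter_le_anti : antisymmetric counter_le.
Proof.
move=> s s' /andP[/asboolP ss' /asboolP s's]; apply: counter_eqP => t.
by apply: le_anti; rewrite ss' s's.
Qed.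

Lemma counter_le_trans : transitive counter_le.
Proof.
move=> s s' s'' /asboolP ss' /asboolP s's''; apply/asboolP => t.
exact: le_trans (s's'' t) (ss' t).
Qed.

Fact counter_display : Order.disp_t. Proof. exact: Order.Disp tt tt. Qed.

HB.instance Definition _ := Order.Le_isPOrder.Build counter_display counter
  counter_le_refl counter_le_anti counter_le_trans.

Lemma counter_leP (s s' : counter) :
  reflect (forall t : int, s' t%:E <= s t%:E) (s <= s')%O.
Proof. exact: asboolP. Qed.

Section JoinMeet.
Variables s s' : counter.

Definition join_fun (t : \bar int) : \bar int := mine (s t) (s' t).
Definition meet_fun (t : \bar int) : \bar int := maxe (s t) (s' t).

Fact join_homo : {homo join_fun : t u / t <= u}.
Proof.
move=> t u tu; rewrite /join_fun le_min !ge_min.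
by rewrite (counter_homo s tu) (counter_homo s' tu) orbT.
Qed.
Fact joinNy : join_fun -oo = -oo. Proof. by rewrite /join_fun !counterNy. Qed.
Fact joiny : join_fun +oo = +oo. Proof. by rewrite /join_fun !countery. Qed.

Fact meet_homo : {homo meet_fun : t u / t <= u}.
Proof.
move=> t u tu; rewrite /meet_fun ge_max !le_max.
by rewrite (counter_homo s tu) (counter_homo s' tu) orbT.
Qed.
Fact meetNy : meet_fun -oo = -oo. Proof. by rewrite /meet_fun !counterNy. Qed.
Fact meety : meet_fun +oo = +oo. Proof. by rewrite /meet_fun !countery. Qed.

Definition counter_join : counter := Counter join_homo joinNy joiny.
Definition counter_meet : counter := Counter meet_homo meetNy meety.

End JoinMeet.

Lemma counter_leUx (x y z : counter) :
  (counter_join x y <= z)%O = (x <= z)%O && (y <= z)%O.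
Proof.
apply/counter_leP/andP => [h|[/counter_leP xz /counter_leP yz] t].
  by split; apply/counter_leP => t;
    move: (h t); rewrite /= /join_fun le_min => /andP[].
by rewrite /= /join_fun le_min xz yz.
Qed.

Lemma counter_lexI (x y z : counter) :
  (x <= counter_meet y z)%O = (x <= y)%O && (x <= z)%O.
Proof.
apply/counter_leP/andP => [h|[/counter_leP xz /counter_leP yz] t].
  by split; apply/counter_leP => t;
    move: (h t); rewrite /= /meet_fun ge_max => /andP[].
by rewrite /= /meet_fun ge_max xz yz.
Qed.

HB.instance Definition _ :=
  Order.POrder_isJoinSemilattice.Build counter_display counter counter_leUx.
HB.instance Definition _ :=
  Order.POrder_isMeetSemilattice.Build counter_display counter counter_lexI.

Definition monomial_fun (n t0 t : \bar int) : \bar int :=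
  match t with
  | -oo => -oo
  | +oo => +oo
  | t%:E => if t%:E <= t0 then n else +oo
  end.

Fact monomial_homo n t0 : {homo monomial_fun n t0 : t u / t <= u}.
Proof.
move=> [t||] [u||] //= tu; rewrite ?leey ?leNye //.
have [ut0|] := boolP (u%:E <= t0); last by rewrite leey.
by rewrite (le_trans tu ut0).
Qed.

(* n delta^t0 *)
Definition monomial (n t0 : \bar int) : counter :=
  Counter (@monomial_homo n t0) erefl erefl.

Lemma counter_le0x (s : counter) : (monomial +oo +oo <= s)%O.
Proof. by apply/counter_leP => t /=; rewrite !leey. Qed.

Lemma counter_lex1 (s : counter) : (s <= monomial -oo +oo)%O.
Proof. by apply/counter_leP => t /=; rewrite leey leNye. Qed.

HB.instance Definition _ :=
  Order.hasBottom.Build counter_display counter counter_le0x.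
HB.instance Definition _ :=
  Order.hasTop.Build counter_display counter counter_lex1.

Lemma counter_joinE (s s' : counter) (t : \bar int) :
  Order.join s s' t = mine (s t) (s' t).
Proof. by []. Qed.

Lemma counter_meetE (s s' : counter) (t : \bar int) :
  Order.meet s s' t = maxe (s t) (s' t).
Proof. by []. Qed.

Section Hadamard.
Variables s1 s2 : counter.

(* +%dE is the addition of \bar int for which +oo + -oo = +oo *)
Definition hadamard_fun (t : \bar int) : \bar int := (s1 t + s2 t)%dE.

Fact hadamard_homo : {homo hadamard_fun : t u / t <= u}.
Proof.
by move=> t u tu; apply: lee_dD; exact: counter_homo.
Qed.
Fact hadamardNy : hadamard_fun -oo = -oo.
Proof. by rewrite /hadamard_fun !counterNy. Qed.
Fact hadamardy : hadamard_fun +oo = +oo.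
Proof. by rewrite /hadamard_fun !countery. Qed.

Definition hadamard : counter := Counter hadamard_homo hadamardNy hadamardy.

End Hadamard.

Definition is_greatest_solution (y a x : counter) : Prop :=
  (hadamard a x <= y)%O /\
  forall z : counter, (hadamard a z <= y)%O -> (z <= x)%O.

(* Residuation in \bar int: y - a, with +oo - +oo = -oo - -oo = -oo, is the
   least v such that y <= a + v. *)
Lemma lee_dual_residual (a v y : \bar int) :
  (y <= (a + v)%dE) = ((y - a)%E <= v).
Proof.
case: a v y => [a||] [v||] [y||] //=; rewrite ?leey ?leNye //.
by rewrite -EFinB -dEFinD !lee_fin lerBlDl.
Qed.

Lemma bar_int_sup (U : set (\bar int)) :
  exists r, forall v, (r <= v) <-> (forall u, U u -> u <= v).
Proof.
have [Uy|nUy] := pselect (U +oo).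
  by exists +oo => v; split=> [vy u _|->//]; exact: le_trans (leey u) vy.
have [[n0 Un0]|nUfin] := pselect (exists n : int, U n%:E); last first.
  exists -oo => v; split=> [_ [u||] Uu|_]; rewrite ?leNye //.
  by case: nUfin; exists u.
have [[b bU]|nbU] := pselect (exists b : int, forall n : int, U n%:E -> (n <= b)%R).
  have ex : exists k : nat, `[< U (b - k%:Z)%:E >].
    exists (absz (b - n0)%R); apply/asboolP; move: (bU _ Un0) => n0b.
    by have -> : (b - (absz (b - n0))%:Z = n0)%R by lia.
  case: (ex_minnP ex) => k /asboolP Uk kmin.
  exists (b - k%:Z)%:E => v; split=> [kv [u||] Uu|/(_ _ Uk)//].
  - apply: le_trans kv; rewrite lee_fin.
    have ub := bU _ Uu.
    have /kmin : `[< U (b - (absz (b - u))%:Z)%:E >].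
      by apply/asboolP; have -> : (b - (absz (b - u))%:Z = u)%R by lia.
    by lia.
  - by case: nUy.
  - exact: leNye.
exists +oo => v; split=> [yv u _|h]; first exact: le_trans (leey u) yv.
case: v h => [b||] h //.
  by case: nbU; exists b => n /h; rewrite lee_fin.
by have := h _ Un0.
Qed.

Lemma greatest_solution_exists (y a : counter) :
  exists x, is_greatest_solution y a x.
Proof.
pose U (t : \bar int) : set (\bar int) :=
  fun u => exists2 s : int, s%:E <= t & u = (y s%:E - a s%:E)%E.
pose f t := projT1 (cid (bar_int_sup (U t))).
have fP t v : (f t <= v) <-> (forall u, U t u -> u <= v).
  by rewrite /f; case: cid => r.
pose g t := if t is +oo then +oo else f t.
have gh : {homo g : t u / t <= u}.
  have fh t u : t <= u -> f t <= f u.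
    move=> tu; apply/fP => _ [s st ->].
    have /fP : f u <= f u by [].
    by apply; exists s => //; exact: le_trans st tu.
  by move=> [t||] [u||] tu //=; rewrite ?leey //; exact: fh.
have gN : g -oo = -oo.
  apply/eqP; rewrite -leeNy_eq; apply/fP => u [s sNy _].
  by move: sNy; rewrite leeNy_eq.
exists (Counter gh gN erefl); split.
  apply/counter_leP => t /=; rewrite /hadamard_fun lee_dual_residual /=.
  by have /fP : f t%:E <= f t%:E by []; apply; exists t.
move=> z /counter_leP az; apply/counter_leP => t /=.
apply/fP => _ [s st ->]; apply: le_trans (counter_homo z st).
by rewrite -lee_dual_residual; exact: az.
Qed.

(* y (.)^# a: the dividend y comes first. *)
Definition hadamard_residual (y a : counter) : counter :=
  projT1 (cid (greatest_solution_exists y a)).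

Lemma hadamard_residualP (y a : counter) :
  is_greatest_solution y a (hadamard_residual y a).
Proof. exact: (projT2 (cid (greatest_solution_exists y a))). Qed.

Definition polynomial_counter (m : nat) (n t : 'I_m -> \bar int) : counter :=
  (\join_(i < m) monomial (n i) (t i))%O.

(* Consecutive strict increase, together with m >= 1 (so that the neutral
   element of the big join never matters). *)
Definition is_polynomial_data (m : nat) (n t : 'I_m -> \bar int) : Prop :=
  (1 <= m)%N /\
  forall i j : 'I_m, j = i.+1 :> nat -> n i < n j /\ t i < t j.

(* Main.v *)
Require Import Defs.
From mathcomp Require Import all_boot all_order all_algebra.
From mathcomp Require Import constructive_ereal.

(** Residuation by a join is the meet of the residuals, by distributivity of
    the Hadamard product over joins.  Residuation of a nonempty finite join by
    a monomial [n0 delta^t0] distributes over the join because the product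
    constraint at times [u <= t] is, by monotonicity, only binding at the single
    time [min t t0]: whichever term attains the join there serves for all
    [u <= t]. *)

Set Implicit Arguments.
Unset Strict Implicit.
Unset Printing Implicit Defensive.

Import Order.TTheory.
Import DualAddTheoryNumDomain DualAddTheoryRealDomain.
Local Open Scope ereal_scope.

Lemma hadamard_le (a x x' : counter) :
  (x <= x')%O -> (hadamard a x <= hadamard a x')%O.
Proof.
by move=> /counter_leP xx'; apply/counter_leP => u; apply: lee_dD.
Qed.

(** The Galois connection behind residuation; the converse of maximality uses that the product is
    monotone in [x]. *)
Lemma le_hadamard_residual (y a x : counter) :
  (x <= hadamard_residual y a)%O = (hadamard a x <= y)%O.
Proof.
have [sol great] := hadamard_residualP y a.
apply/idP/idP => [xr|]; last exact: great.
exact: le_trans (hadamard_le a xr) sol.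
Qed.

Lemma counter_joins_attained (I : finType) (i0 : I) (y : I -> counter)
    (u : int) :
  exists i, y i u%:E <= (\join_i y i)%O u%:E.
Proof.
elim/big_rec: _ => [|i s _ [k ks]].
  (* The empty join is [+oo] at every integer, so any index bounds it. *)
  exists i0; rewrite (_ : \bot%O = monomial +oo +oo) //.
  by rewrite [leRHS]/= !leey.
rewrite counter_joinE; have [si|si] := leP (y i u%:E) (s u%:E).
  by exists i.
by exists k.
Qed.

Lemma hadamard_residual_joinsr (I : finType) (i0 : I) (y : counter)
    (a : I -> counter) :
  hadamard_residual y (\join_i a i)%O = (\meet_i hadamard_residual y (a i))%O.
Proof.
apply: le_anti; apply/andP; split.
  apply/meetsP => i _; rewrite le_hadamard_residual.
  have := lexx (hadamard_residual y (\join_i a i)%O).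
  rewrite le_hadamard_residual; apply: le_trans.
  have /counter_leP ai : (a i <= \join_i a i)%O by exact: joins_sup.
  by apply/counter_leP => u; apply: lee_dD.
rewrite le_hadamard_residual; apply/counter_leP => u.
(* The index may depend on [u], since the inequality is checked one time at a time. *)
have [i ai] := counter_joins_attained i0 a u.
have : (\meet_i hadamard_residual y (a i) <= hadamard_residual y (a i))%O.
  exact: meets_inf.
rewrite le_hadamard_residual => /counter_leP/(_ u)/le_trans; apply.
exact: lee_dD.
Qed.

(** Past [t] or [t0] one factor is [+oo], which absorbs even [-oo] in the dual addition. *)
Lemma hadamard_monomial_le (n0 t0 v : \bar int) (t : int) (s : counter) :
  (forall u : int, u%:E <= t%:E -> u%:E <= t0 -> s u%:E <= (n0 + v)%dE) ->
  (hadamard (monomial n0 t0) (monomial v t%:E) <= s)%O.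
Proof.
move=> sv; apply/counter_leP => u; rewrite /= /hadamard_fun /=.
case: ifP => ut0; last by rewrite leey.
by case: ifP => ut; [exact: sv | rewrite daddey leey].
Qed.

Lemma hadamard_residual_joinsl (I : finType) (i0 : I) (y : I -> counter)
    (n0 t0 : \bar int) :
  hadamard_residual (\join_i y i)%O (monomial n0 t0) =
  (\join_i hadamard_residual (y i) (monomial n0 t0))%O.
Proof.
apply: le_anti; apply/andP; split; last first.
  apply/joinsP => i _; rewrite le_hadamard_residual.
  apply: (@le_trans _ _ (y i)); last exact: joins_sup.
  by rewrite -le_hadamard_residual.
set x := hadamard_residual _ _.
have /counter_leP xP : (hadamard (monomial n0 t0) x <= \join_i y i)%O.
  by rewrite -le_hadamard_residual.
apply/counter_leP => t.
(* The monomial of value [x t] up to [t] lies below [x] and agrees with it at [t], so it can replace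
   [x] there. *)
suff [i] : exists i,
    (hadamard (monomial n0 t0) (monomial (x t%:E) t%:E) <= y i)%O.
  rewrite -le_hadamard_residual => xi.
  have /counter_leP/(_ t) : (monomial (x t%:E) t%:E <=
      \join_i hadamard_residual (y i) (monomial n0 t0))%O.
    by apply: le_trans xi _; exact: (@joins_sup _ _ _ i).
  by rewrite /= lexx.
(* Here [s] is the last constrained time, and [y i u <= y i s <= n0 + x s <= n0 + x t]. *)
have binding (s : int) : s%:E <= t%:E -> s%:E <= t0 ->
    (forall u : int, u%:E <= t%:E -> u%:E <= t0 -> u%:E <= s%:E) ->
    exists i, (hadamard (monomial n0 t0) (monomial (x t%:E) t%:E) <= y i)%O.
  move=> st st0 smax; have [i yi] := counter_joins_attained i0 y s.
  exists i; apply: hadamard_monomial_le => // u ut ut0.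
  apply: le_trans (counter_homo (y i) (smax u ut ut0)) _.
  apply: le_trans yi _; apply: le_trans (xP s) _.
  rewrite /= /hadamard_fun /= st0.
  by apply: lee_dD => //; exact: counter_homo.
case: t0 @x xP binding => [r||] x xP binding.
- have [tr|rt] := leP t%:E r%:E.
    by apply: (binding t).
  by apply: (binding r) => //; exact: ltW.
- by apply: (binding t); rewrite ?leey.
(* No integer time is constrained: each residual is the top counter, and [i0] keeps the join from
   being empty, hence bottom. *)
- by exists i0; apply: hadamard_monomial_le => // u _; rewrite leeNy_eq.
Qed.

Theorem proposition3p6 (m m' : nat) (n t : 'I_m -> \bar int)
    (n' t' : 'I_m' -> \bar int)
    (hp : is_polynomial_data n t) (hp' : is_polynomial_data n' t') :
  hadamard_residual (polynomial_counter n t) (polynomial_counter n' t') =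
  (\meet_(j < m') \join_(i < m)
     hadamard_residual (monomial (n i) (t i)) (monomial (n' j) (t' j)))%O.
Proof.
case: hp hp' => m_gt0 _ [m'_gt0 _].
rewrite (hadamard_residual_joinsr (Ordinal m'_gt0)).
apply: eq_bigr => j _.
exact: (hadamard_residual_joinsl (Ordinal m_gt0)).
Qed.
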